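(* Let $X$ be a Lindelöf Čech-complete space of countable pseudocharacter (for example, $X$ is a Polish space). Then $B_1(X)$ is normal if and only if $X$ is countable. In this case $B_1(X)=\mathbb R^X$ is a separable metrizable space.
   Context: $B_1(X)$ is the set of all functions $X\to\mathbb R$ that are pointwise limits of sequences of continuous functions $X\to\mathbb R$, endowed with the topology of pointwise convergence inherited from $\mathbb R^X$. Čech-complete spaces are Tychonoff by definition. Countable pseudocharacter: every point is the intersection of countably many open sets. *)

(* Defs.v *)
From HB Require Import structures.
From mathcomp Require Import all_boot all_order all_algebra.
From mathcomp Require Import all_classical all_reals all_analysis.
From mathcomp Require Import borel_hierarchy.

Set Implicit Arguments.
Unset Strict Implicit.
Unset Printing Implicit Defensive.

Import Order.TTheory GRing.Theory Num.Theory.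
Import numFieldNormedType.Exports.

Local Open Scope classical_set_scope.
Local Open Scope ring_scope.

Definition lindelof (X : topologicalType) : Prop :=
  forall C : set (set X),
    C `<=` open -> \bigcup_(U in C) U = [set: X] ->
    exists D : set (set X),
      [/\ D `<=` C, countable D & \bigcup_(U in D) U = [set: X]].

Definition countable_pseudocharacter (X : topologicalType) : Prop :=
  forall x : X, Gdelta [set x].

Definition tychonoff_space (X : topologicalType) : Prop :=
  accessible_space X /\ completely_regular_space X.

Definition embedding (X Y : topologicalType) (f : X -> Y) : Prop :=
  injective f /\ @open X = [set f @^-1` V | V in @open Y].

Definition homeomorphism (X Y : topologicalType) (f : X -> Y) : Prop :=
  embedding f /\ range f = [set: Y].

Definition compactification (X K : topologicalType) (e : X -> K) : Prop :=
  [/\ hausdorff_space K, compact [set: K], embedding e & dense (range e)].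

(* That the image is Gdelta in one compactification, in every one, or in the
   Stone-Cech one are equivalent conditions on a Tychonoff space. *)
Definition cech_complete (X : topologicalType) : Prop :=
  tychonoff_space X /\
  exists (K : topologicalType) (e : X -> K),
    compactification e /\ Gdelta (range e).

Definition separable_space (X : topologicalType) : Prop :=
  exists2 D : set X, countable D & dense D.

Definition metrizable (R : realType) (X : topologicalType) : Prop :=
  exists (M : metricType R) (f : X -> M), homeomorphism f.

Definition complete_space (M : uniformType) : Prop :=
  forall F : set_system M, ProperFilter F -> cauchy F -> exists x : M, F --> x.

Definition polish_space (R : realType) (X : topologicalType) : Prop :=
  separable_space X /\
  exists (M : metricType R) (f : X -> M), complete_space M /\ homeomorphism f.

(* Used as a type, [B1 R X] carries the topology induced by the product
   topology of {ptws X -> R}. *)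
Definition B1 (R : realType) (X : topologicalType) : set {ptws X -> R} :=
  [set f | exists2 g : nat -> X -> R,
     (forall n, continuous (g n)) &
     (forall x, g n x @[n --> \oo] --> f x)].

Arguments B1 R X _ : clear implicits.

(* Main.v *)
Require Import Defs.
From HB Require Import structures.
From mathcomp Require Import all_boot all_order all_algebra.
From mathcomp Require Import all_classical all_reals all_analysis.
From mathcomp Require Import borel_hierarchy lra.
Import Order.TTheory GRing.Theory Num.Theory.
Import numFieldNormedType.Exports.
Local Open Scope classical_set_scope.
Local Open Scope ring_scope.

Set Implicit Arguments.
Unset Strict Implicit.
Unset Printing Implicit Defensive.

(** The two substantial points are that normality of [B1 R X] forces [X] to be
    countable, and that a Polish space is Cech-complete.

    Let [X] be uncountable, Lindelof, Cech-complete, with points that are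
    Gdelta. The points without an open neighbourhood of countable closure form
    a nonempty set with no isolated point ([lindelof_crowded_subset]): the
    Lindelof property and the Gdelta points make every locally countable part
    countable. Inside a compactification [K] in which [X] is the intersection
    of open sets [O n], a Cantor scheme that starts from this set and has
    closures at level [n + 1] lying in [O n] has all its branches converging to
    points of [X]. Urysohn functions separate the left from the right pieces of
    each level, and their series with weights [4^-n] is a continuous real
    function [q] which is continuous and injective along the Cantor set of
    branches [xs t] ([cantor_scheme]).

    The functions [z |-> 1 / (q z - q (xs t))], with value [0] where the
    denominator vanishes, are of Baire class one. They form a closed discrete
    family of size continuum: at the point [xs s] the [t]-th function tends to
    infinity as [t] tends to [s], and the Cantor set is compact
    ([inv_family_closed]). All of them factor through [q], hence they lie in the
    closure of the countable set of polynomials in [q] with rational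
    coefficients ([ratpoly_dense]). By the argument of Jones, a normal space has
    no closed discrete set of size continuum in the closure of a countable set
    ([jones]). Restricting to functions of [q] is what makes the separability
    in Jones' lemma available although [B1 R X] need not be separable.

    Conversely, over a countable [X] any function is the limit of continuous
    functions which agree with it on larger and larger finite sets, and the
    pointwise topology is given by a weighted supremum distance
    ([countable_metrizable]), so [B1 R X] is metrizable, hence normal.

    A Polish space with distance [d] is embedded in the cube of all functions
    from [X] to the unit interval by [x |-> min 1 (d x _)]. The closure of the
    image is a compactification, and by completeness the points of it that
    belong, for each [n], to an open set of trace of diameter less than
    [1 / (n + 1)] are exactly those of [X] ([complete_Gdelta]). *)

(** * The topology of pointwise convergence and subspaces *)

Lemma ptws_eval_continuous (R : realType) (X : topologicalType) (x : X) :
  continuous (fun f : {ptws X -> R} => f x : R).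
Proof. exact: (@proj_continuous X (fun=> R) x). Qed.

(** The basic sets on the right generate a filter, and that filter converges to
    [f] coordinatewise; this avoids handling the subbase of the product
    topology. *)
Lemma nbhs_ptwsP (R : realType) (X : topologicalType) (f : {ptws X -> R})
    (U : set {ptws X -> R}) :
  nbhs f U <-> exists s : seq X, exists2 e : R, 0 < e &
    [set g : {ptws X -> R} | forall x, x \in s -> `|f x - g x| < e] `<=` U.
Proof.
pose V (se : seq X * R) : set {ptws X -> R} :=
  [set g | forall x, x \in se.1 -> `|f x - g x| < se.2].
pose F : set_system {ptws X -> R} := filter_from [set se | 0 < se.2] V.
have FF : Filter F.
  apply: filter_from_filter; first by exists ([::], 1) => /=.
  move=> [s d] [t e] /= d0 e0; exists (s ++ t, Num.min d e) => /=.
    by rewrite lt_min d0.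
  move=> g Vg; split => x /= xs; have := Vg x; rewrite /= mem_cat xs ?orbT.
    by rewrite lt_min => /(_ isT)/andP[].
  by rewrite lt_min => /(_ isT)/andP[].
split.
  suff /[apply] : F --> f by move=> [[s e] /= e0 sU]; exists s, e.
  apply/cvg_sup => x U' /= [_ [[W oW <-] Wfx WU]].
  have /nbhs_ballP[e /= e0 eW] : nbhs (f x) W by exact: open_nbhs_nbhs.
  exists ([:: x], e) => //= g Vg; apply: WU; apply: eW; apply: Vg.
  by rewrite /= mem_head.
move=> [s [e e0 /filterS]]; apply.
have Nx (x : X) : \forall g \near f, `|f x - g x| < e.
  have /(_ _ (nbhsx_ballx (f x) e e0)) := @ptws_eval_continuous R X x f.
  exact.
elim: s => [|x s IHs]; first by apply: (@filterE _ (nbhs f)) => g x.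
refine (@filterS _ (nbhs f) _ _ _ _ (@filterI _ (nbhs f) _ _ _ (Nx x) IHs)).
move=> g [gx gs] y /=.
by rewrite in_cons => /predU1P[->//|]; exact: gs.
Qed.

Lemma ptws_hausdorff (R : realType) (X : topologicalType) :
  hausdorff_space {ptws X -> R}.
Proof. by apply: hausdorff_product => x; exact: Rhausdorff. Qed.

Lemma nbhs_set_typeP (T : topologicalType) (A : set T) (x : A) (U : set A) :
  nbhs x U <-> exists2 V, nbhs (set_val x) V & set_val @^-1` V `<=` U.
Proof.
split=> [[_ [[V oV <-] Vx VU]]|[V Vx]]; first by exists V => //; exact: open_nbhs_nbhs.
by move=> /filterS; apply; exact: (@initial_continuous _ _ (@set_val T A)).
Qed.

(** * Embeddings and homeomorphisms *)

Lemma embedding_nbhs (X Y : topologicalType) (f : X -> Y) (x : X) (U : set X) :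
  embedding f -> nbhs x U <-> exists2 V, nbhs (f x) V & f @^-1` V `<=` U.
Proof.
move=> [_ fop]; split.
  rewrite nbhsE => -[W []]; rewrite fop => -[V oV <-] Vx VU.
  by exists V => //; exact: open_nbhs_nbhs.
move=> [V]; rewrite nbhsE => -[W [oW Wx] WV] /(subset_trans _) VU.
rewrite nbhsE; exists (f @^-1` W); last by apply: VU => y; exact: WV.
by split => //; rewrite fop; exists W.
Qed.

Lemma nbhs_homeomorphism (X Y : topologicalType) (f : X -> Y) :
  injective f -> range f = [set: Y] ->
  (forall x V, nbhs (f x) V <-> nbhs x (f @^-1` V)) -> homeomorphism f.
Proof.
move=> finj fsurj fnbhs; split => //; split => //.
apply/seteqP; split => [U oU|_ [V oV <-]].
  exists (f @` U); last first.
    by apply/seteqP; split => [x [y Uy /finj <-]//|x Ux]; exists x.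
  rewrite openE => _ [x Ux <-]; apply/fnbhs.
  by apply: filterS (open_nbhs_nbhs (conj oU Ux)) => y Uy; exists y.
rewrite openE => x Vx; apply/fnbhs.
exact: open_nbhs_nbhs.
Qed.

Lemma embedding_closed (X Y : topologicalType) (f : X -> Y) (A : set X) :
  embedding f -> closed A -> exists2 B, closed B & A = f @^-1` B.
Proof.
move=> [_ fop]; rewrite -openC fop => -[V oV VA].
exists (~` V); first by rewrite closedC.
by rewrite -preimage_setC VA setCK.
Qed.

Lemma homeomorphism_normal (R : realType) (X Y : topologicalType) (f : X -> Y) :
  homeomorphism f -> normal_space Y -> normal_space X.
Proof.
move=> [ef fsurj] /(@normal_openP R) nY; apply/(@normal_openP R) => A B clA clB.
have [A' clA' ->] := embedding_closed ef clA.
have [B' clB' ->] := embedding_closed ef clB => AB.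
have AB' : A' `&` B' = set0.
  apply/seteqP; split => // y [Ay By].
  have [x _ xy] : range f y by rewrite fsurj.
  by rewrite -[set0 y]/(set0 x) -AB; split; rewrite /= xy.
have [U [V [oU oV AU BV UV]]] := nY _ _ clA' clB' AB'.
have [_ fop] := ef.
exists (f @^-1` U), (f @^-1` V); split.
- by rewrite fop; exists U.
- by rewrite fop; exists V.
- exact: preimage_subset.
- exact: preimage_subset.
- by rewrite -preimage_setI UV preimage_set0.
Qed.

Lemma embedding_continuous (X Y : topologicalType) (f : X -> Y) :
  embedding f -> continuous f.
Proof. by move=> [_ fop]; apply/continuousP => V oV; rewrite fop; exists V. Qed.

(** It is often easier to compare neighbourhoods than open sets: the union of
    all the open [V] with preimage inside [U] is the open set to pull back. *)
Lemma nbhs_embedding (X Y : topologicalType) (f : X -> Y) :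
  injective f -> continuous f ->
  (forall x U, nbhs x U -> exists2 V, nbhs (f x) V & f @^-1` V `<=` U) ->
  embedding f.
Proof.
move=> finj cf fnbhs; split => //; apply/seteqP; split => [U oU|_ [V oV <-]].
  exists (\bigcup_(V in [set V | open V /\ f @^-1` V `<=` U]) V).
    by apply: bigcup_open => V [].
  apply/seteqP; split => [x [V [_ VU] Vx]|x Ux]; first exact: VU.
  have [V] := fnbhs _ _ (open_nbhs_nbhs (conj oU Ux)).
  rewrite nbhsE => -[W [oW Wx] WV] VU; exists W => //; split => // y Wy.
  by apply: VU; exact: WV.
by apply: open_comp => // x _; exact: cf.
Qed.

Lemma embedding_tychonoff (R : realType) (X Y : topologicalType) (f : X -> Y) :
  embedding f -> tychonoff_space Y -> tychonoff_space X.
Proof.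
move=> ef [aY crY]; have [finj _] := ef; have cf := embedding_continuous ef.
split=> [x y xy|a B clB nBa].
  have [|V [oV Vx nVy]] := aY (f x) (f y).
    by apply: contra_neq xy; exact: finj.
  exists (f @^-1` V); rewrite !inE /= in Vx nVy *; split => //.
  by apply: open_comp => // z _; exact: cf.
have [B' clB' BB'] := embedding_closed ef clB.
have nB'a : ~ B' (f a) by move=> B'a; apply: nBa; rewrite BB'.
have [u [cu u01 ua uB]] := iffLR (@uniform_separatorP _ R _ _) (crY _ _ clB' nB'a).
apply/(@uniform_separatorP _ R); exists (u \o f); split.
- by move=> x; apply: continuous_comp; [exact: cf|exact: cu].
- by move=> _ [x _ <-]; apply: u01; exists (f x).
- by move=> _ [_ -> <-]; apply: ua; exists (f a).
- by move=> _ [x Bx <-]; apply: uB; exists (f x) => //; rewrite BB' in Bx.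
Qed.

(** * Density of rational polynomials *)

Lemma poly_interpolation (F : fieldType) (s : seq F) (f : F -> F) :
  exists p : {poly F}, forall x, x \in s -> p.[x] = f x.
Proof.
elim: s => [|a s [p ps]]; first by exists 0.
have [as_|nas] := boolP (a \in s).
  by exists p => x; rewrite in_cons => /predU1P[->|]; exact: ps.
pose r := \prod_(b <- s) ('X - b%:P) : {poly F}.
have ra : r.[a] != 0 by rewrite -rootE root_prod_XsubC.
exists (p + ((f a - p.[a]) / r.[a])%:P * r) => x.
rewrite in_cons hornerD hornerM hornerC => /predU1P[->|xs].
  by rewrite divfK// subrKC.
suff /rootP -> : root r x by rewrite mulr0 addr0 ps.
by rewrite root_prod_XsubC.
Qed.

(** Horner's scheme: the error made on the quotient by ['X] is multiplied by at
    most [M], a bound for the absolute values of the points of [s]. *)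
Lemma poly_rat_approx (R : realType) (s : seq R) (p : {poly R}) (e : R) :
  0 < e -> exists r : {poly rat}, forall x, x \in s ->
    `|p.[x] - (map_poly ratr r).[x]| < e.
Proof.
elim/poly_ind: p e => [|p c IHp] e e0.
  by exists 0 => x _; rewrite rmorph0 subrr normr0.
pose M := 1 + \sum_(x <- s) `|x|.
have M0 : 0 < M by rewrite ltr_pwDl// sumr_ge0.
have sM x : x \in s -> `|x| <= M.
  move=> xs; rewrite /M (big_rem x xs)/= addrCA lerDl.
  by rewrite addr_ge0// sumr_ge0.
have [r rP] := IHp (e / 2 / M) (divr_gt0 (divr_gt0 e0 (ltr0n _ 2)) M0).
have [d] := rat_in_itvoo (ltr_pwDr (divr_gt0 e0 (ltr0n _ 2)) (lexx c)).
rewrite in_itv/= => /andP[cd dc].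
exists (r * 'X + d%:P) => x xs.
rewrite rmorphD rmorphM/= map_polyX map_polyC/= !hornerMXaddC.
rewrite opprD addrACA -mulrBl (le_lt_trans (ler_normD _ _))//.
rewrite [ltRHS](splitr e) ler_ltD//; last first.
  by rewrite distrC ger0_norm ?subr_ge0 ?(ltW cd)// ltrBlDl.
rewrite normrM (le_trans (ler_wpM2r (normr_ge0 _) (ltW (rP x xs))))//.
by rewrite mulrAC ler_pdivrMr// ler_pM2l ?divr_gt0// sM.
Qed.

Definition ratpoly (R : realType) (X : Type) (q : X -> R) (p : {poly rat})
  (x : X) : R := (map_poly ratr p).[q x].

(** A neighbourhood only looks at finitely many points, so that a function which
    factors through [q] can first be interpolated by a polynomial in [q], whose
    coefficients are then perturbed into rational ones. *)
Lemma ratpoly_dense (R : realType) (X : topologicalType) (q : X -> R)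
    (F : R -> R) (U : set {ptws X -> R}) :
  nbhs (F \o q : {ptws X -> R}) U -> exists p, U (ratpoly q p).
Proof.
move=> /nbhs_ptwsP[s [e e0 sU]].
have [p pF] := poly_interpolation (map q s) F.
have [r rp] := poly_rat_approx (map q s) p e0.
exists r; apply: sU => x xs /=; rewrite -pF ?map_f//.
by apply: rp; rewrite map_f.
Qed.

(** * Jones' lemma *)

(** For each set [A] of indices choose an open set [U A] containing [f @` A] whose
    closure avoids the rest of the family. The trace of [U A] on the countable
    set [D] determines [A], which would inject the subsets of [nat -> bool] in
    [nat -> bool]. *)
Lemma jones (R : realType) (Y : topologicalType) (D : set Y)
    (f : (nat -> bool) -> Y) :
  countable D -> range f `<=` closure D -> injective f ->
  (forall A, closed (f @` A)) -> ~ normal_space Y.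
Proof.
move=> /countable_injP[h hinj] fD finj fcl nY.
have sepf (A : set (nat -> bool)) : exists U : set Y,
    [/\ open U, f @` A `<=` U & closure U `&` f @` (~` A) = set0].
  have dA : f @` A `&` f @` (~` A) = set0.
    apply/seteqP; split => // y [[a Aa <-] [b nAb /finj ba]].
    by apply: nAb; rewrite ba.
  have [U [V [oU oV AU AV UV]]] :=
    iffLR (@normal_openP R Y) nY _ _ (fcl A) (fcl (~` A)) dA.
  exists U; split => //; apply/seteqP; split => // y [Uy /AV Vy].
  have [z] := Uy V (open_nbhs_nbhs (conj oV Vy)).
  by rewrite UV.
pose U A := projT1 (cid (sepf A)).
have oU A : open (U A) by have [] := projT2 (cid (sepf A)).
have AU A : f @` A `<=` U A by have [] := projT2 (cid (sepf A)).
have UA A : closure (U A) `&` f @` (~` A) = set0.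
  by have [] := projT2 (cid (sepf A)).
pose code A : nat -> bool := fun n => `[< exists y, [/\ D y, h y = n & U A y] >].
have codeP A B : code A = code B -> A `<=` B.
  move=> AB t At; apply: contrapT => nBt.
  have nUBt : ~ closure (U B) (f t).
    by move=> UBt; have : set0 (f t) by rewrite -(UA B); split => //; exists t.
  have ot : nbhs (f t) (U A `&` ~` closure (U B)).
    apply: open_nbhs_nbhs; split; last by split => //; apply: AU; exists t.
    by apply: openI => //; exact/closed_openC/closed_closure.
  have [y [Dy [UAy nUBy]]] := fD _ (imageT f t) _ ot.
  have : code A (h y) by apply/asboolP; exists y.
  rewrite AB => /asboolP[z [Dz /hinj zy UBz]]; apply: nUBy.
  by apply: subset_closure; rewrite -zy ?inE.
(* Cantor's diagonal set for the injection [code]. *)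
pose A : set (nat -> bool) := [set t | exists2 B, code B = t & ~ B t].
have nA : ~ A (code A).
  move=> /[dup] AA [B BA]; apply; exact: codeP (esym BA) _ AA.
by apply: (nA); exists A.
Qed.

(** * A closed discrete family of Baire-one functions *)

(** As [0^-1 = 0], the function is also defined, with value [0], on the fiber of
    [q] through [xs t]. *)
Definition inv_family (R : realType) (T : Type) (X : Type) (q : X -> R)
  (xs : T -> X) (t : T) (z : X) : R := (q z - q (xs t))^-1.

(** The continuous functions [u / (u ^ 2 + 1 / (n + 1))] converge pointwise to
    [1 / u], including at the zeros of [u] where all of them vanish. *)
Lemma inv_family_B1 (R : realType) (T : Type) (X : topologicalType) (q : X -> R)
    (xs : T -> X) t : continuous q -> B1 R X (inv_family q xs t).
Proof.
move=> cq; pose u z := q z - q (xs t).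
have cu : continuous u by move=> z; apply: cvgB; [exact: cq|exact: cvg_cst].
exists (fun n z => u z / (u z * u z + n.+1%:R^-1)).
  move=> n z; apply: cvgM; first exact: cu.
  apply: cvgV; last by apply: cvgD; [apply: cvgM; exact: cu|exact: cvg_cst].
  by rewrite gt_eqF// ltr_wpDl// -expr2 sqr_ge0.
move=> z; rewrite /inv_family -/(u z).
have [->|u0] := eqVneq (u z) 0.
  by rewrite invr0; under eq_fun do rewrite mul0r; exact: cvg_cst.
have -> : (u z)^-1 = u z / (u z * u z + 0).
  by rewrite addr0 invfM mulrA divff// mul1r.
apply: cvgM; first exact: cvg_cst.
apply: cvgV; first by rewrite addr0 mulf_neq0.
by apply: cvgD; [exact: cvg_cst|exact: cvg_harmonic].
Qed.

(** Let [g] lie outside of the family. Near an index [s], the other members of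
    the family take at [xs s] values larger than [`|g (xs s)| + 1], so a
    neighbourhood of [g] contains none of those with index close to [s]; by
    compactness of [T] finitely many such neighbourhoods suffice. *)
Lemma inv_family_closed (R : realType) (T X : topologicalType) (q : X -> R)
    (xs : T -> X) (A : set T) :
  compact [set: T] -> continuous (q \o xs) -> injective (q \o xs) ->
  closed ((fun t => inv_family q xs t : {ptws X -> R}) @` A).
Proof.
move=> /compact_near_coveringP Tco cc cinj; rewrite -openC openE => g gA.
pose P (h : {ptws X -> R}) (t : T) := A t -> inv_family q xs t <> h.
suff : \forall h \near g, [set: T] `<=` P h.
  by apply: filterS => h hP [t At th]; exact: (hP t I At th).
apply: (Tco _ (nbhs g) P) => s _; rewrite /P.
have Ng : \forall h \near g, A s -> inv_family q xs s <> h.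
  have [As|nAs] := pselect (A s); last by apply: (@filterE _ (nbhs g)).
  have sg : inv_family q xs s != g :> {ptws X -> R}.
    by apply/eqP => sg; apply: gA; exists s.
  have := @hausdorff_accessible _ (@ptws_hausdorff R X) g (inv_family q xs s).
  rewrite eq_sym => /(_ sg)[W [oW]]; rewrite !inE => Wg nWs.
  refine (@filterS _ (nbhs g) _ _ _ _ (open_nbhs_nbhs (conj oW Wg))).
  by move=> h Wh _ sh; apply: nWs; rewrite sh.
have Mg : \forall h \near g, `|h (xs s)| < `|g (xs s)| + 1.
  have := @ptws_eval_continuous R X (xs s) g _ (nbhsx_ballx (g (xs s)) 1 ltr01).
  apply: (@filterS _ (nbhs g)) => h /=; rewrite -ball_normE/= => gh.
  have := ler_normD (g (xs s)) (h (xs s) - g (xs s)).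
  rewrite subrKC => /le_lt_trans; apply.
  by rewrite ltrD2l distrC.
have M0 : 0 < (`|g (xs s)| + 1)^-1 by rewrite invr_gt0 ltr_pwDr.
have Ns : \forall t \near s, `|q (xs s) - q (xs t)| < (`|g (xs s)| + 1)^-1.
  have := cc s _ (nbhsx_ballx (q (xs s)) _ M0).
  by [].
exists ([set t | `|q (xs s) - q (xs t)| < (`|g (xs s)| + 1)^-1],
  [set h : {ptws X -> R} | `|h (xs s)| < `|g (xs s)| + 1 /\
     (A s -> inv_family q xs s <> h)]).
  by split => //=; exact: (@filterI _ (nbhs g) _ _ _ Mg Ng).
move=> [t h]/= [st [hs Ash]] At th.
have [tsE|ts] := pselect (t = s); first by move: th; rewrite tsE; apply: Ash; rewrite -tsE.
have st0 : q (xs s) - q (xs t) != 0.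
  by rewrite subr_eq0; apply/eqP => /cinj /esym.
move: hs; rewrite -th /inv_family normfV ltNge => /negP; apply.
rewrite -[leLHS]invrK lef_pV2 ?posrE ?normr_gt0//.
exact: ltW.
Qed.

(** The [s]-th function vanishes at [xs s], and the other ones do not. *)
Lemma inv_family_inj (R : realType) (T X : Type) (q : X -> R) (xs : T -> X) :
  injective (q \o xs) -> injective (inv_family q xs).
Proof.
move=> qinj s t /(congr1 (fun f => f (xs s)))/esym/eqP.
by rewrite /inv_family subrr invr0 invr_eq0 subr_eq0 => /eqP/qinj.
Qed.

(** * Encoding binary sequences by a series *)

(** Any positive ratio below [1 / 2] would do to make the series of 0-1 sequences
    injective; with [1 / 4] the tail after a term is at most a third of it. *)
Definition quartic_partial (R : realType) (T : Type) (u : nat -> T -> R) (n : nat)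
  (x : T) : R := \sum_(0 <= i < n) u i x * 4^-1 ^+ i.

Definition quartic (R : realType) (T : Type) (u : nat -> T -> R) (x : T) : R :=
  lim (quartic_partial u ^~ x @ \oo).

Section quartic.
Context (R : realType) (T : Type) (u : nat -> T -> R).
Hypothesis u01 : forall n x, 0 <= u n x <= 1.

Let S := quartic_partial u.

Let w0 n : 0 < 4^-1 ^+ n :> R.
Proof. by rewrite exprn_gt0. Qed.

Lemma quartic_partialS n x : S n.+1 x = S n x + u n x * 4^-1 ^+ n.
Proof. by rewrite /S /quartic_partial big_nat_recr. Qed.

Lemma quartic_partial_nd x : nondecreasing_seq (S ^~ x).
Proof.
apply/nondecreasing_seqP => n; rewrite quartic_partialS lerDl.
by rewrite mulr_ge0 ?(ltW (w0 n))//; case/andP: (u01 n x).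
Qed.

(** The constant is the sum of the geometric series of ratio [4^-1]. *)
Lemma quartic_partial_le n m x :
  S (n + m) x <= S n x + 4 / 3 * (4^-1 ^+ n - 4^-1 ^+ (n + m)).
Proof.
elim: m => [|m IHm]; first by rewrite addn0 subrr mulr0 addr0.
rewrite addnS quartic_partialS; have /andP[_ u1] := u01 (n + m) x.
have := ler_wpM2r (ltW (w0 (n + m))) u1; rewrite mul1r exprS; lra.
Qed.

Lemma quartic_partial_ub n m x : S m x <= S n x + 4 / 3 * 4^-1 ^+ n.
Proof.
have [mn|nm] := leqP m n.
  apply: (le_trans (quartic_partial_nd x mn)).
  by rewrite lerDl mulr_ge0// ltW.
rewrite -(subnKC (ltnW nm)) (le_trans (quartic_partial_le _ _ _))// lerD2l.
by rewrite ler_wpM2l// gerBl ltW.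
Qed.

Lemma quartic_is_cvg x : cvgn (S ^~ x).
Proof.
apply: (nondecreasing_is_cvgn (quartic_partial_nd x)).
exists (S 0 x + 4 / 3 * 4^-1 ^+ 0) => _ [n _ <-].
exact: quartic_partial_ub.
Qed.

Lemma quartic_ge n x : S n x <= quartic u x.
Proof.
exact: (nondecreasing_cvgn_le (quartic_partial_nd x) (@quartic_is_cvg x) n).
Qed.

Lemma quartic_le n x : quartic u x <= S n x + 4 / 3 * 4^-1 ^+ n.
Proof.
apply: limr_le; first exact: quartic_is_cvg.
by apply: nearW => m; exact: quartic_partial_ub.
Qed.

End quartic.

Lemma quartic_continuous (R : realType) (T : topologicalType)
    (u : nat -> T -> R) :
  (forall n x, 0 <= u n x <= 1) -> (forall n, continuous (u n)) ->
  continuous (quartic u).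
Proof.
move=> u01 cu x.
have cS n : continuous (quartic_partial u n).
  elim: n => [|n IHn] y.
    have -> : quartic_partial u 0 = cst 0.
      by apply: funext => z; rewrite /quartic_partial big_geq.
    exact: cvg_cst.
  have -> : quartic_partial u n.+1 =
      (fun z => quartic_partial u n z + u n z * 4^-1 ^+ n).
    by apply: funext => z; exact: quartic_partialS.
  by apply: cvgD; [exact: IHn|apply: cvgM; [exact: cu|exact: cvg_cst]].
apply/cvgrPdist_lt => e e0.
have [n ne] : exists n, 4 / 3 * 4^-1 ^+ n < e / 2.
  have : 4 / 3 * 4^-1 ^+ n @[n --> \oo] --> (4 / 3 * 0 : R).
    by apply: cvgM; [exact: cvg_cst|apply: cvg_expr; rewrite ger0_norm// invf_lt1// ltr1n].
  rewrite mulr0 => /cvgrPdist_lt/(_ _ (divr_gt0 e0 (ltr0n _ 2)))[n _ nP].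
  exists n; have := nP n (leqnn n).
  by rewrite /= sub0r normrN; apply: le_lt_trans; exact: ler_norm.
have := cS n x _ (nbhsx_ballx _ _ (divr_gt0 e0 (ltr0n _ 2))).
apply: (@filterS _ (nbhs x)) => y; rewrite /ball/= !ltr_norml => /andP[xy1 xy2].
have qx1 := quartic_ge u01 n x; have qx2 := quartic_le u01 n x.
have qy1 := quartic_ge u01 n y; have qy2 := quartic_le u01 n y.
apply/andP; split; lra.
Qed.

(** At the first place where two sequences differ, the gap [4^-n] exceeds
    whatever the tail can make up for. *)
Lemma quartic_inj (R : realType) :
  injective (quartic (fun n (t : nat -> bool) => (t n)%:R : R)).
Proof.
pose u n (t : nat -> bool) := (t n)%:R : R.
have u01 n t : 0 <= u n t <= 1 by rewrite /u; case: (t n); rewrite ?lexx ?ler01.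
have lt_q n t s : (forall i, (i < n)%N -> t i = s i) -> ~~ t n -> s n ->
    quartic u t < quartic u s.
  move=> ts tn sn.
  have St : quartic_partial u n.+1 t = quartic_partial u n t.
    by rewrite quartic_partialS /u (negbTE tn) mul0r addr0.
  have Ss : quartic_partial u n.+1 s = quartic_partial u n t + 4^-1 ^+ n.
    rewrite quartic_partialS /u sn mul1r; congr (_ + _).
    by apply: eq_big_nat => i /andP[_ /ts ->].
  have := quartic_ge u01 n.+1 s; have := quartic_le u01 n.+1 t.
  rewrite St Ss exprS; have : 0 < 4^-1 ^+ n :> R by rewrite exprn_gt0.
  lra.
move=> t s qts; apply: contrapT => ts.
have exn : exists n, t n != s n.
  apply: contrapT => /forallNP ts'; apply: ts; apply: funext => n.
  by apply/eqP/negPn/negP/ts'.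
case: (ex_minnP exn) => n tsn nmin.
have ltn i : (i < n)%N -> t i = s i.
  by move=> ni; apply/eqP; apply: contraTT ni => /nmin; rewrite -leqNgt.
case tn: (t n); case sn: (s n); try by rewrite tn sn eqxx in tsn.
  have := lt_q n s t (fun i ni => esym (ltn i ni)) (negbT sn) tn.
  by rewrite -/u in qts; rewrite qts ltxx.
have := lt_q n t s ltn (negbT tn) sn.
by rewrite -/u in qts; rewrite qts ltxx.
Qed.

(** * Cantor schemes in compact spaces *)

(** Two distinct points of [E] in [U] have disjoint neighbourhoods, which
    regularity shrinks until their closures are inside [U `&` O]. *)
Lemma crowded_split (K : topologicalType) (E U O : set K) :
  hausdorff_space K -> compact [set: K] ->
  (forall z W, E z -> nbhs z W -> exists z', [/\ E z', W z' & z' != z]) ->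
  open U -> open O -> U `&` E !=set0 -> E `<=` O ->
  exists V : bool -> set K, [/\ forall b, open (V b),
    forall b, V b `&` E !=set0, forall b, closure (V b) `<=` U `&` O &
    closure (V false) `&` closure (V true) = set0].
Proof.
move=> hK cK crE oU oO [z [Uz Ez]] EO.
have regK (x : K) (W : set K) : open W -> W x ->
    exists V : set K, [/\ open V, V x & closure V `<=` W].
  move=> oW Wx.
  have [V Vx VW] := @compact_regular K x _ hK cK filterT W
    (open_nbhs_nbhs (conj oW Wx)).
  exists V°; split; [exact: open_interior|exact: Vx|].
  exact: subset_trans (closureS (@interior_subset _ _)) VW.
have [z' [Ez' Uz' zz']] := crE z U Ez (open_nbhs_nbhs (conj oU Uz)).
move: (hK); rewrite open_hausdorff => /(_ _ _ zz')[[A B]/= [+ +] [oA oB /eqP AB]].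
rewrite !inE => Az' Bz.
have UO x : E x -> U x -> (U `&` O) x by move=> /EO.
have oUO : open (U `&` O) by exact: openI.
have [P [oP Pz PW]] := regK z _ (openI oUO oB) (conj (UO z Ez Uz) Bz).
have [Q [oQ Qz QW]] := regK z' _ (openI oUO oA) (conj (UO z' Ez' Uz') Az').
exists (fun b => if b then Q else P); split.
- by case.
- by case; [exists z'|exists z].
- by case => x; [move=> /QW[]|move=> /PW[]].
- apply/seteqP; split => // x [/PW[_ Bx] /QW[_ Ax]].
  by rewrite -AB.
Qed.

Lemma compact_decreasing_closures (K : topologicalType) (C : nat -> set K) :
  compact [set: K] -> (forall n, C n !=set0) -> (forall n, C n.+1 `<=` C n) ->
  exists x, forall n, closure (C n) x.
Proof.
move=> cK C0 Cdec.
have Cle n m : (n <= m)%N -> C m `<=` C n.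
  move=> /subnKC <-; elim: (m - n)%N => [|k IHk]; first by rewrite addn0.
  by rewrite addnS; apply: subset_trans (Cdec _) IHk.
have FF : ProperFilter (filter_from [set: nat] C).
  apply: filter_from_proper => [|n _]; last exact: C0.
  apply: filter_from_filter; first by exists 0%N.
  move=> n m _ _; exists (maxn n m) => // x Cx; split; apply: Cle Cx.
    exact: leq_maxl.
  exact: leq_maxr.
have [x [_ xC]] := cK _ FF (filterS (fun _ _ => I) (filterT)).
by exists x => n B Bx; apply: xC => //; exists n.
Qed.

Section cantor_scheme.
Context (R : realType) (K : topologicalType) (E : set K) (O : nat -> set K).
Hypotheses (hK : hausdorff_space K) (cK : compact [set: K]).
Hypotheses (E0 : E !=set0) (oO : forall n, open (O n)).
Hypothesis EO : forall n, E `<=` O n.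
Hypothesis crE : forall z W, E z -> nbhs z W ->
  exists z', [/\ E z', W z' & z' != z].

Let splits (n : nat) (U : set K) (V : bool -> set K) :=
  [/\ forall b, open (V b),
    forall b, V b `&` E !=set0, forall b, closure (V b) `<=` U `&` O n &
    closure (V false) `&` closure (V true) = set0].

(** Letters are added in front of a word, so that the piece of [b :: s] is inside
    the piece of [s]. *)
Lemma cantor_scheme_ex : exists V : seq bool -> set K,
  [/\ forall s, open (V s), forall s, V s `&` E !=set0,
    forall b s, closure (V (b :: s)) `<=` V s `&` O (size s) &
    forall s s', size s = size s' -> s != s' ->
      closure (V s) `&` closure (V s') = set0].
Proof.
have /choice[f fP] : forall nU : nat * set K, exists V,
    open nU.2 -> nU.2 `&` E !=set0 -> splits nU.1 nU.2 V.
  move=> [n U] /=.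
  have [[oU UE]|nU] := pselect (open U /\ U `&` E !=set0); last first.
    by exists (fun=> set0) => oU UE; case: nU.
  by have [V VP] := crowded_split hK cK crE oU (@oO n) UE (@EO n); exists V.
pose V := fix V s := if s is b :: s' then f (size s', V s') b else [set: K].
have [oV VE] : (forall s, open (V s)) /\ (forall s, V s `&` E !=set0).
  suff VP s : open (V s) /\ V s `&` E !=set0.
    by split => s; have [] := VP s.
  elim: s => [|b s [oV VE]]/=.
    by rewrite setTI; split => //; exact: openT.
  by have [] := fP (size s, V s) oV VE.
have Vs s : splits (size s) (V s) (f (size s, V s)) by exact: (fP (size s, V s) (oV s) (VE s)).
have clV b s : closure (V (b :: s)) `<=` V s `&` O (size s).
  by have [_ _ + _] := Vs s; apply.
exists V; split => //.
elim=> [|b s IHs] [|b' s']//= [ss'] nss'.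
have [ss|nss] := eqVneq s s'.
  rewrite -ss in nss' *; have [_ _ _] := Vs s.
  by case: b b' nss' => -[]; rewrite ?eqxx// setIC.
apply/seteqP; split => // x [/clV[Vsx _] /clV[Vs'x _]].
by rewrite -(IHs _ ss' nss); split; exact: subset_closure.
Qed.

(* The word [t n :: ... :: t 0] is read backwards, so that extending a branch
   prepends a letter. *)
Let branch (t : nat -> bool) := fix branch n :=
  if n is n'.+1 then t n' :: branch n' else [::].

Let size_branch t n : size (branch t n) = n.
Proof. by elim: n => //= n ->. Qed.

(** The Urysohn function of level [n] reads off the [n]-th letter of a branch, so
    that [q] evaluates at the end of the branch [t] to the series with digits
    [t], whose continuity and injectivity in [t] are known. *)
Lemma cantor_scheme : exists (q : K -> R) (ys : cantor_space -> K),
  [/\ continuous q, forall t n, O n (ys t), continuous (q \o ys) &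
    injective (q \o ys)].
Proof.
have [V [oV VE clV Vdisj]] := cantor_scheme_ex.
(* The union of the pieces at level [n + 1] whose most recent letter, the
     head of the word, is [b]. *)
pose A (b : bool) n := \bigcup_(s in [set: n.-tuple bool]) closure (V (b :: s)).
have clA b n : closed (A b n).
  apply: closed_bigcup => [|s _]; first exact: finite_finset.
  exact: closed_closure.
have AA n : A false n `&` A true n = set0.
  apply/seteqP; split => // x [[s _ sx] [s' _ s'x]].
  rewrite -(Vdisj (false :: s) (true :: s'))//=.
  by rewrite !size_tuple.
have /choice[u uP] : forall n, exists u : K -> R, [/\ continuous u,
    forall x, 0 <= u x <= 1, forall x, A false n x -> u x = 0 &
    forall x, A true n x -> u x = 1].
  move=> n; have /(@normal_separatorP R) nK := compact_normal hK cK.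
  have [u [cu u01 u0 u1]] := iffLR (@uniform_separatorP _ R _ _)
    (nK _ _ (clA false n) (clA true n) (AA n)).
  exists u; split => //.
  - by move=> x; have := u01 (u x) (imageT u x); rewrite /= in_itv.
  - by move=> x Ax; apply: u0; exists x.
  - by move=> x Ax; apply: u1; exists x.
have /choice[ys ysP] : forall t : cantor_space, exists x,
    forall n, closure (V (branch t n)) x.
  move=> t; apply: compact_decreasing_closures => // n.
    by have [x []] := VE (branch t n); exists x.
  by move=> x /subset_closure /clV[].
have u01 n x : 0 <= u n x <= 1 by have [] := uP n.
have uys n t : u n (ys t) = (t n)%:R.
  have := ysP t n.+1; have [_ _ u0 u1] := uP n => /= ysn.
  have Ays : A (t n) n (ys t).
    have sz : size (branch t n) == n by rewrite size_branch.
    by exists (Tuple sz).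
  by move: Ays; case: (t n) => [/u1|/u0].
have qys : quartic u \o ys = quartic (fun n (t : nat -> bool) => (t n)%:R : R).
  apply: funext => t; rewrite /quartic /=; congr (lim (_ @ \oo)).
  by apply: funext => n; apply: eq_bigr => i _; rewrite uys.
exists (quartic u), ys; split.
- by apply: quartic_continuous => // n; have [] := uP n.
- move=> t n; have /= /clV[_] := ysP t n.+1.
  by rewrite size_branch.
- rewrite qys; apply: (@quartic_continuous R cantor_space).
    by move=> n t; case: (t n); rewrite ?lexx ?ler01.
  move=> n; have cn : continuous (fun t : cantor_space => t n).
    exact: (@proj_continuous nat (fun=> bool) n).
  move=> t; apply: (@continuous_comp cantor_space bool R (fun t => t n)
    (fun b : bool => b%:R : R)); first exact: cn.
  by move=> W /nbhs_singleton Wb; apply: filterS (discrete_set1 _) => _ ->.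
- by rewrite qys; exact: quartic_inj.
Qed.

End cantor_scheme.

(** * Normality forces countability *)

(** The open sets with countable trace on [F], among which is the complement of
    [F], cover the space. *)
Lemma lindelof_locally_countable (X : topologicalType) (F : set X) :
  lindelof X -> closed F ->
  (forall x, F x -> exists2 U, open U & U x /\ countable U) -> countable F.
Proof.
move=> lX clF locF.
have [||D [DC cD DT]] := lX [set U | open U /\ countable (U `&` F)].
- by move=> U [].
- apply/seteqP; split => // x _.
  have [/locF[U oU [Ux cU]]|nFx] := pselect (F x).
    exists U => //; split => //; apply: sub_countable cU.
    by apply: subset_card_le; exact: subIsetl.
  exists (~` F) => //; split; first by rewrite openC.
  by rewrite setICl; exact: countable0.
rewrite -[F]setTI -DT setI_bigcupl.
by apply: bigcup_countable => // U /DC[].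
Qed.

(** Let [E] be the set of points without an open neighbourhood of countable
    closure. Suppose that [z] is the only point of [E] in a neighbourhood [W],
    and take [V] with closure in [W]. Then [closure V] is the union of [z] and of the closed
    sets [closure V `&` ~` G n], where [G n] are open sets intersecting in
    [z]. These closed sets miss [E], so they are countable, and so is
    [closure V]: this contradicts that [z] is in [E]. *)
Lemma lindelof_crowded_subset (X : topologicalType) :
  lindelof X -> regular_space X -> countable_pseudocharacter X ->
  ~ countable [set: X] ->
  exists2 E : set X, E !=set0 & forall z W, E z -> nbhs z W ->
    exists z', [/\ E z', W z' & z' != z].
Proof.
move=> lX rX gX ncX.
pose E : set X := [set x | ~ exists2 U, open U & U x /\ countable (closure U)].
have nE x : ~ E x -> exists2 U, open U & U x /\ countable U.
  move=> /contrapT[U oU [Ux cU]]; exists U => //; split => //.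
  by apply: sub_countable cU; apply: subset_card_le; exact: subset_closure.
exists E.
  apply/set0P/eqP => E0; apply: ncX.
  by apply: lindelof_locally_countable => // x _; apply: nE; rewrite E0.
move=> z W Ez Wz; apply: contrapT => noz; apply: (Ez).
have [V Vz VW] := rX z _ Wz.
exists V°; first exact: open_interior.
split; first exact: Vz.
have [G oG zG] := gX z.
suff : countable (\bigcup_(o in [set: option nat])
    (if o is Some n then closure V `&` ~` G n else [set z])).
  apply: sub_countable; apply: subset_card_le => x Vx.
  have {}Vx : closure V x by apply: closureS Vx; exact: interior_subset.
  have [->|xz] := eqVneq x z; first by exists None.
  apply: contrapT => nx; move/eqP: xz; apply.
  rewrite -[x = z]/([set z] x) zG => n _; apply: contrapT => nGx.
  by apply: nx; exists (Some n).
apply: bigcup_countable => // -[n|] _; last exact: countable1.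
apply: lindelof_locally_countable => //.
  by apply: closedI; [exact: closed_closure|exact/open_closedC/oG].
move=> x [Vx nGx]; apply: nE => Ex; apply: noz; exists x; split => //.
  exact: VW.
apply/eqP => xz; apply: nGx; have : [set z] x by [].
by rewrite zG; apply.
Qed.

Lemma normal_B1_countable (R : realType) (X : topologicalType) :
  lindelof X -> cech_complete X -> countable_pseudocharacter X ->
  normal_space (B1 R X) -> countable [set: X].
Proof.
move=> lX [[_ crX] [K [e [[hK cK ee _] [G oG eG]]]]] gX nB.
apply: contrapT => ncX.
have [einj _] := ee.
have rX : regular_space X by exact: (@completely_regular_regular R).
have [E [z0 Ez0] crE] := lindelof_crowded_subset lX rX gX ncX.
have ce := embedding_continuous ee.
have eE z W : (e @` E) z -> nbhs z W -> exists z', [/\ (e @` E) z', W z' & z' != z].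
  move=> [x Ex <-] /ce Wx; have [x' [Ex' Wx' xx']] := crE x _ Ex Wx.
  exists (e x'); split => //.
  by apply/eqP => /einj xx; move/eqP: xx'; apply.
have E1 : e @` E !=set0 by exists (e z0), z0.
have EG n : e @` E `<=` G n.
  by move=> _ [x _ <-]; have : range e (e x) by []; rewrite eG; apply.
have [q [ys [cq Gys cqys qysinj]]] := @cantor_scheme R K _ _ hK cK E1 oG EG eE.
have /choice[xs xsP] : forall t, exists x, e x = ys t.
  move=> t; have : (\bigcap_n G n) (ys t) by move=> n _; exact: Gys.
  by rewrite -eG => -[x _ <-]; exists x.
pose p x := q (e x).
have cp : continuous p.
  by move=> x; apply: (@continuous_comp X K R); [exact: ce|exact: cq].
have pxs : p \o xs = q \o ys by apply: funext => t /=; rewrite /p xsP.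
pose f t : B1 R X := SigSub (mem_set (inv_family_B1 xs t cp)).
have B1p r : B1 R X (ratpoly p r).
  exists (fun=> ratpoly p r) => [_ x|x]; last exact: cvg_cst.
  apply: (@continuous_comp X R R p (horner (map_poly ratr r))); first exact: cp.
  exact: continuous_horner.
pose D : set (B1 R X) := range (fun r => SigSub (mem_set (B1p r)) : B1 R X).
have qxsinj : injective (p \o xs) by rewrite pxs.
have finj : injective f.
  by move=> s t /(congr1 set_val) /= /(inv_family_inj qxsinj).
apply: (@jones R _ D f _ _ finj _ nB).
- by apply: sub_countable (card_image_le _ _) _; exact: countableP.
- move=> _ [t _ <-] U /nbhs_set_typeP[V Vt VU].
  have [r Vr] := @ratpoly_dense R X p (fun a => (a - p (xs t))^-1) V Vt.
  by exists (SigSub (mem_set (B1p r))); split; [exists r|exact: VU].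
- move=> A; have clA : closed (set_val @^-1`
      ((fun t => inv_family p xs t : {ptws X -> R}) @` A) : set (B1 R X)).
    apply: closed_comp => [h _|]; first exact: initial_continuous.
    apply: (@inv_family_closed R cantor_space X p xs A) => //; first exact: cantor_space_compact.
    by rewrite pxs.
  have -> // : f @` A = set_val @^-1`
      ((fun t => inv_family p xs t : {ptws X -> R}) @` A).
  apply/seteqP; split => [_ [t At <-]|h [t At th]]; exists t => //.
  exact: val_inj.
Qed.

(** * Baire-one functions on a countable space *)

(** A new point [a] is treated by adding a multiple of a function which is [1] at
    [a] and vanishes on the points already interpolated. *)
Lemma tychonoff_interpolation (R : realType) (X : topologicalType)
    (s : seq X) (f : X -> R) :
  tychonoff_space X -> exists2 g : X -> R, continuous g &
    forall x, x \in s -> g x = f x.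
Proof.
move=> [aX crX]; elim: s => [|a s [g cg gs]].
  by exists (cst 0) => // x; exact: cvg_cst.
have [as_|nas] := boolP (a \in s).
  by exists g => // x; rewrite in_cons => /predU1P[->|]; exact: gs.
have cls : closed [set` s].
  by apply: (iffLR (@accessible_finite_set_closed X) aX); exact: finite_seq.
have [u [cu _ ua us]] := iffLR (@uniform_separatorP _ R _ _)
  (crX a _ cls (negP nas)).
exists (fun x => g x + (f a - g a) * (1 - u x)) => [x|x].
  apply: cvgD; first exact: cg.
  by apply: cvgM; [exact: cvg_cst|apply: cvgB; [exact: cvg_cst|exact: cu]].
rewrite in_cons => /predU1P[->|xs].
  by rewrite (ua (u a)) ?subr0 ?mulr1 ?subrKC//; exists a.
by rewrite (us (u x)) ?subrr ?mulr0 ?addr0 ?gs//; exists x.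
Qed.

Lemma countable_initial_seq (X : eqType) (h : X -> nat) (n : nat) :
  injective h -> exists s : seq X, forall x, (x \in s) = (h x < n)%N.
Proof.
move=> hinj; elim: n => [|n [s sP]]; first by exists [::].
have [[x xn]|nx] := pselect (exists x, h x = n).
  exists (x :: s) => y; rewrite in_cons sP ltnS [RHS]leq_eqVlt.
  by rewrite -(inj_eq hinj) xn.
exists s => y; rewrite sP ltnS [RHS]leq_eqVlt; case: eqP => // yn.
by case: nx; exists y.
Qed.

Lemma B1_countable (R : realType) (X : topologicalType) :
  tychonoff_space X -> countable [set: X] -> B1 R X = [set: {ptws X -> R}].
Proof.
move=> tX /countable_injP[h hinj]; apply/seteqP; split => // f _.
have {}hinj : injective h by move=> x y; apply: hinj; rewrite inE.
have /choice[g gP] : forall n, exists g : X -> R, continuous g /\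
    forall x, (h x < n)%N -> g x = f x.
  move=> n; have [s sP] := countable_initial_seq n hinj.
  have [g cg gs] := tychonoff_interpolation s f tX.
  by exists g; split => // x; rewrite -sP; exact: gs.
exists g => [n|x]; first by have [] := gP n.
apply: cvg_near_cst; exists (h x).+1 => // n /= hn.
by have [_ ->] := gP n.
Qed.

(** An injection of [X] in the integers makes every function on [X] a function of
    a single real variable, so the density of rational polynomials applies. *)
Lemma B1_countable_separable (R : realType) (X : topologicalType) :
  countable [set: X] -> B1 R X = [set: {ptws X -> R}] ->
  separable_space (B1 R X).
Proof.
move=> /countable_injP[h hinj] B1T.
have {}hinj : injective h by move=> x y; apply: hinj; rewrite inE.
pose q (x : X) : R := (h x)%:R.
have B1p r : B1 R X (ratpoly q r) by rewrite B1T.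
exists (range (fun r => SigSub (mem_set (B1p r)) : B1 R X)).
  by apply: sub_countable (card_image_le _ _) _; exact: countableP.
move=> U [g Ug] oU.
have /choice[F FP] : forall a, exists b, forall x, q x = a -> set_val g x = b.
  move=> a; have [[x xa]|nx] := pselect (exists x, q x = a).
    exists (set_val g x) => y; rewrite -xa => /eqP.
    by rewrite eqr_nat => /eqP/hinj ->.
  by exists 0 => x xa; case: nx; exists x.
have gF : set_val g = F \o q by apply: funext => x; exact: FP.
have /nbhs_set_typeP[V gV VU] := open_nbhs_nbhs (conj oU Ug).
rewrite gF in gV; have [r Vr] := ratpoly_dense gV.
by exists (SigSub (mem_set (B1p r))); split; [exact: VU|exists r].
Qed.

(** * Metrizability over a countable set *)

Lemma metrizable_normal (R : realType) (X : topologicalType) :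
  metrizable R X -> normal_space X.
Proof.
move=> [M [f fh]]; apply: (@homeomorphism_normal R X M f fh).
exact: (@pseudometric_normal R).
Qed.

(** A copy of [A] to carry the metric structure, since [A] already has a topology
    as a subspace of a product. *)
Definition weighted (X : Type) (R : realType) (h : X -> nat)
  (A : set (X -> R)) : Type := A.

Section weighted.
Context (X : Type) (R : realType) (h : X -> nat) (A : set (X -> R)).
Implicit Types f g k : A.

Let c (x : X) : R := (h x).+1%:R^-1.

Let term f g (o : option X) : R :=
  if o is Some x then Num.min `|set_val f x - set_val g x| (c x) else 0.

(** The supremum over [x] of [min (`|f x - g x|) (1 / (h x + 1))]; the extra
    index [None] keeps the set of terms nonempty when [X] is empty. *)
Definition weighted_dist f g : R := sup (range (term f g)).

Let c0 x : 0 < c x.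
Proof. by rewrite invr_gt0 ltr0n. Qed.

Let has_sup_term f g : has_sup (range (term f g)).
Proof.
split; first by exists 0, None.
exists 1 => _ [[x|] _ <-] //=; rewrite ge_min; apply/orP; right.
by rewrite invf_le1 ?ler1n ?ltr0n.
Qed.

Lemma weighted_dist_ge0 f g : 0 <= weighted_dist f g.
Proof. by apply: ub_le_sup; [have [] := has_sup_term f g|exists None]. Qed.

Lemma weighted_dist_leP f g (e : R) : 0 <= e -> weighted_dist f g <= e <->
  forall x, Num.min `|set_val f x - set_val g x| (c x) <= e.
Proof.
move=> e0; split=> [fge x|fge].
  apply: le_trans fge; apply: ub_le_sup; last by exists (Some x).
  by have [] := has_sup_term f g.
apply: ge_sup => [|_ [[x|] _ <-]].
- by case: (has_sup_term f g).
- exact: fge.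
- exact: e0.
Qed.

Let weighted_distxx f : weighted_dist f f = 0.
Proof.
apply/eqP; rewrite eq_le weighted_dist_ge0 andbT.
by apply/weighted_dist_leP => // x; rewrite subrr normr0 ge_min lexx.
Qed.

Let weighted_dist_positivity f g : weighted_dist f g = 0 -> f = g.
Proof.
move=> fg0; apply: val_inj; apply: funext => x.
have /weighted_dist_leP - /(_ (lexx 0) x) : weighted_dist f g <= 0 by rewrite fg0.
rewrite ge_min [c x <= 0]leNgt (c0 x) orbF normr_le0 subr_eq0.
by move=> /eqP.
Qed.

Let weighted_dist_sym f g : weighted_dist f g = weighted_dist g f.
Proof.
suff : term f g = term g f by rewrite /weighted_dist => ->.
by apply: funext => -[x|]//=; rewrite distrC.
Qed.

Let weighted_dist_triangle g f k :
  weighted_dist f k <= weighted_dist f g + weighted_dist g k.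
Proof.
apply/weighted_dist_leP => [|x]; first by rewrite addr_ge0 ?weighted_dist_ge0.
have /weighted_dist_leP - /(_ (weighted_dist_ge0 f g) x) := lexx (weighted_dist f g).
have /weighted_dist_leP - /(_ (weighted_dist_ge0 g k) x) := lexx (weighted_dist g k).
have := weighted_dist_ge0 f g; have := weighted_dist_ge0 g k.
have := ler_distD (set_val g x) (set_val f x) (set_val k x).
have := c0 x.
rewrite !ge_min => cx fk gk0 fg0 /orP[gk|gk] /orP[fg|fg]; apply/orP.
- by left; rewrite (le_trans fk)// lerD.
- by right; rewrite (le_trans fg)// lerDl.
- by right; rewrite (le_trans gk)// lerDr.
- by right; rewrite (le_trans fg)// lerDl.
Qed.

HB.instance Definition _ := gen_eqMixin (weighted h A).
HB.instance Definition _ := gen_choiceMixin (weighted h A).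
HB.instance Definition _ := @isMetric.Build R (weighted h A) weighted_dist
  weighted_distxx weighted_dist_positivity weighted_dist_sym
  weighted_dist_triangle.

End weighted.

(** If [h] is injective, only finitely many points have a weight above a given
    positive number, so that small balls constrain finitely many values. *)
Lemma countable_metrizable (R : realType) (X : topologicalType)
    (A : set {ptws X -> R}) : countable [set: X] -> metrizable R A.
Proof.
move=> /countable_injP[h hinj].
have {}hinj : injective h by move=> x y; apply: hinj; rewrite inE.
pose M : metricType R := weighted h (A : set (X -> R)).
exists M, (id : A -> M); apply: nbhs_homeomorphism => //.
  by apply/seteqP; split => // f _; exists f.
move=> f U.
rewrite -(@metricType_numDomainType.filter_from_mdist_nbhs R M f).
rewrite nbhs_set_typeP; split.
- move=> [e e0 eU].
  have [n ne] : exists n : nat, n.+1%:R^-1 < e.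
    have := near_infty_natSinv_lt (PosNum e0) => -[n _ nP].
    by exists n; apply: nP => /=.
  have [s sP] := countable_initial_seq n.+1 hinj.
  exists [set g : {ptws X -> R} | forall x, x \in s ->
      `|set_val f x - g x| < n.+1%:R^-1].
    by apply/nbhs_ptwsP; exists s, n.+1%:R^-1 => //; rewrite invr_gt0.
  move=> g /= gs; apply: eU => /=; apply: le_lt_trans ne.
  apply/weighted_dist_leP => [|x]; first by rewrite invr_ge0.
  rewrite ge_min; have [xs|] := boolP (x \in s); first by rewrite (ltW (gs x xs)).
  rewrite sP -leqNgt => nx; rewrite lef_pV2 ?posrE// ler_nat ltnS (ltnW nx).
  by rewrite orbT.
- move=> [V /nbhs_ptwsP[s [e e0 sV]] VU].
  have [d [d0 de ds]] : exists d : R, [/\ 0 < d, d <= e &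
      forall x, x \in s -> d <= (h x).+1%:R^-1].
    elim: s {sV} => [|x s [d [d0 de ds]]]; first by exists e.
    exists (Num.min d (h x).+1%:R^-1); split.
    + by rewrite lt_min d0 invr_gt0/=.
    + by rewrite ge_min de.
    + move=> y; rewrite in_cons => /predU1P[->|ys]; first by rewrite ge_min lexx orbT.
      by rewrite ge_min ds.
  exists d => // g /= gd; apply: VU; apply: sV => x xs /=.
  have /weighted_dist_leP - /(_ (weighted_dist_ge0 _ _ _) x) :=
    lexx (weighted_dist h f g).
  move=> /le_lt_trans/(_ gd); rewrite gt_min => /orP[/lt_le_trans-> //|].
  by rewrite ltNge ds.
Qed.

(** * Polish spaces *)

(** A filter on the subspace is pushed to the ambient space, where it clusters at
    a point of [A]. *)
Lemma compact_set_type (Y : topologicalType) (A : set Y) :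
  compact A -> compact [set: A].
Proof.
move=> cA F PF _; pose G := set_val @ F.
have GA : G A by apply: (@filterE _ F) => x; exact: set_valP.
have [p [Ap Gp]] := cA G _ GA.
exists (SigSub (mem_set Ap)); split => // B U FB /nbhs_set_typeP[V Vp VU].
have GB : G (set_val @` B) by apply: (@filterS _ F) FB => x Bx; exists x.
have [_ [[x Bx <-] Vx]] := Gp _ _ GB Vp.
by exists x; split => //; exact: VU.
Qed.

Lemma hausdorff_set_type (Y : topologicalType) (A : set Y) :
  hausdorff_space Y -> hausdorff_space A.
Proof.
move=> hY p q pq; apply: val_inj; apply: hY => B U pB qU.
have pB' : nbhs p (set_val @^-1` B) by apply/nbhs_set_typeP; exists B.
have qU' : nbhs q (set_val @^-1` U) by apply/nbhs_set_typeP; exists U.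
have [z [Bz Uz]] := pq _ _ pB' qU'.
by exists (set_val z).
Qed.

Lemma closure_compactification (X Y : topologicalType) (f : X -> Y) :
  hausdorff_space Y -> embedding f -> compact (closure (range f)) ->
  exists e : X -> closure (range f), compactification e.
Proof.
move=> hY [finj fop] cf.
have clf x : closure (range f) (f x) by apply: subset_closure; exists x.
pose e x : closure (range f) := SigSub (mem_set (clf x)).
exists e; split.
- exact: hausdorff_set_type.
- exact: compact_set_type.
- split; first by move=> x y /(congr1 set_val) /finj.
  rewrite fop; apply/seteqP; split => [_ [V oV <-]|_ [_ [V oV <-] <-]].
    by exists (set_val @^-1` V) => //; exists V.
  by exists V.
- move=> U [z Uz] oU; have /nbhs_set_typeP[V Vz VU] := open_nbhs_nbhs (conj oU Uz).
  have [_ [[x _ <-] Vx]] := set_valP z V Vz.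
  by exists (e x); split; [exact: VU|exists x].
Qed.

Section distance.
Context (R : realType) (X : topologicalType) (d : X -> X -> R).
Hypothesis d0 : forall x, d x x = 0.
Hypothesis d_eq0 : forall x y, d x y = 0 -> x = y.
Hypothesis d_ge0 : forall x y, 0 <= d x y.
Hypothesis d_sym : forall x y, d x y = d y x.
Hypothesis d_tri : forall y x z, d x z <= d x y + d y z.
Hypothesis d_nbhs : forall x U, nbhs x U <->
  exists2 e : R, 0 < e & [set y | d x y < e] `<=` U.

Let ex_inv (e : R) : 0 < e -> exists n : nat, n.+1%:R^-1 < e.
Proof.
move=> e0; have [n _ nP] := near_infty_natSinv_lt (PosNum e0).
by exists n; apply: nP => /=.
Qed.

Lemma distance_ball_open x e : open [set y | d x y < e].
Proof.
rewrite openE => y /= xy; apply/d_nbhs; exists (e - d x y); first by rewrite subr_gt0.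
by move=> z /= yz; rewrite (le_lt_trans (d_tri y x z))// -ltrBrDl.
Qed.

Lemma distance_countable_pseudocharacter : countable_pseudocharacter X.
Proof.
move=> x; exists (fun n => [set y | d x y < n.+1%:R^-1]).
  by move=> n; exact: distance_ball_open.
apply/seteqP; split => [_ -> n _ /=|y xy]; first by rewrite d0.
apply/esym/d_eq0/eqP; rewrite eq_le d_ge0 andbT leNgt; apply/negP => /ex_inv[n].
by rewrite ltNge => /negP; apply; exact/ltW/xy.
Qed.

(** The balls with center in a countable dense set and radius [1 / (n + 1)] which
    fit in some member of the cover still cover [X]; one member for each of them
    is enough. *)
Lemma distance_lindelof : separable_space X -> lindelof X.
Proof.
move=> [D cD dD] C Copen CT.
pose P (an : X * nat) (U : set X) := C U /\ [set y | d an.1 y < an.2.+1%:R^-1] `<=` U.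
pose S : set (X * nat) := [set an | D an.1 /\ exists U, P an U].
have /choice[g gP] : forall an, exists U, S an -> P an U.
  move=> an; have [[_ [U anU]]|nS] := pselect (S an); first by exists U.
  by exists set0.
exists (g @` S); split.
- by move=> _ [an /gP[] + _ <-].
- apply: sub_countable (card_image_le _ _) _.
  have := countableX cD (countableP [set: nat]).
  apply: sub_countable; apply: subset_card_le => -[a n] [Da _].
  by split.
- apply/seteqP; split => // x _.
  have [U CU Ux] : (\bigcup_(U in C) U) x by rewrite CT.
  have /d_nbhs[e e0 eU] := open_nbhs_nbhs (conj (Copen U CU) Ux).
  have [n ne] := ex_inv (divr_gt0 e0 (ltr0n R 2)).
  have [|a [xa Da]] := dD _ _ (distance_ball_open x n.+1%:R^-1).
    by exists x; rewrite /= d0.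
  have San : S (a, n).
    split => //; exists U; split => // y /= ay; apply: eU => /=.
    rewrite (le_lt_trans (d_tri a x y))// (splitr e) ltrD//.
      by rewrite (lt_trans _ ne).
    by rewrite (lt_trans _ ne).
  exists (g (a, n)); first by exists (a, n).
  by have [_] := gP _ San; apply; rewrite /= d_sym.
Qed.

(** The truncation at [1] puts the image in a compact cube. *)
Let trunc (x : X) : {ptws X -> R} := fun y => Num.min 1 (d x y).

Lemma distance_embedding : embedding trunc.
Proof.
apply: nbhs_embedding.
- move=> x y /(congr1 (fun f => f y)); rewrite /trunc d0 => xy.
  apply: d_eq0; apply/eqP; rewrite eq_le d_ge0 andbT.
  have : Num.min 1 (d x y) <= 0 by rewrite xy ge_min lexx orbT.
  by rewrite ge_min ler10.
- move=> x V /nbhs_ptwsP[s [e e0 sV]]; apply/d_nbhs; exists e => // y /= xy.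
  apply: sV => z _; rewrite /trunc.
  have xz := d_tri y x z; have := d_tri x y z; rewrite (d_sym y x) => yz.
  rewrite ltr_norml !minEle; case: (leP 1 (d x z)); case: (leP 1 (d y z)) => ? ?;
    apply/andP; split; lra.
- move=> x U /d_nbhs[e e0 eU].
  exists [set k : {ptws X -> R} | forall y, y \in [:: x] ->
      `|trunc x y - k y| < Num.min 1 e].
    by apply/nbhs_ptwsP; exists [:: x], (Num.min 1 e) => //; rewrite lt_min ltr01.
  move=> y /= /(_ x (mem_head _ _)) xy; apply: eU; rewrite /= d_sym.
  move: xy; rewrite /trunc d0 ltr_norml => /andP[+ _].
  rewrite !minEle ler10; case: (leP 1 (d y x)); case: (leP 1 e) => ? ?; lra.
Qed.

Lemma distance_compact_closure : compact (closure (range trunc)).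
Proof.
have c01 : compact [set f : {ptws X -> R} | forall x, `[(0:R), 1]%classic (f x)].
  exact: (@tychonoff X (fun=> R) (fun=> `[(0:R), 1]%classic)
    (fun=> @segment_compact R 0 1)).
have := compact_closed (@ptws_hausdorff R X) c01; rewrite closure_id => c01E.
apply: subclosed_compact c01 _; first exact: closed_closure.
rewrite c01E; apply: closureS => _ [x _ <-] y /=.
by rewrite in_itv /= le_min ler01 d_ge0 ge_min lexx.
Qed.

Hypothesis d_complete : forall F : set_system X, ProperFilter F ->
  (forall e : R, 0 < e -> exists2 S, F S & forall x y, S x -> S y -> d x y < e) ->
  exists x : X, F --> x.

(** A point [z] which is for each [n] in an open set with trace of diameter less
    than [1 / (n + 1)] makes the traces of its neighbourhoods a Cauchy filter on
    [X]; the image of its limit is [z] since [K] is Hausdorff. *)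
Lemma complete_Gdelta (K : topologicalType) (e : X -> K) :
  hausdorff_space K -> embedding e -> dense (range e) -> Gdelta (range e).
Proof.
move=> hK ee De; have ce := embedding_continuous ee.
pose small n (V : set K) :=
  open V /\ forall x y, V (e x) -> V (e y) -> d x y < n.+1%:R^-1.
exists (fun n => \bigcup_(V in small n) V).
  by move=> n; apply: bigcup_open => V [].
apply/seteqP; split => [_ [x _ <-] n _|z zO].
  have h0 : 0 < n.+1%:R^-1 / 2 :> R by rewrite divr_gt0.
  have Nx : nbhs x [set y | d x y < n.+1%:R^-1 / 2] by apply/d_nbhs; exists (n.+1%:R^-1 / 2).
  have [V + VU] := iffLR (embedding_nbhs _ _ ee) Nx.
  rewrite nbhsE => -[W [oW Wx] WV]; exists W => //; split => // y y' /WV/VU/= xy /WV/VU/= xy'.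
  by rewrite (le_lt_trans (d_tri x y y'))// (splitr n.+1%:R^-1) ltrD// d_sym.
pose F := filter_from (nbhs z) (fun V => e @^-1` V).
have PF : ProperFilter F.
  apply: filter_from_proper => [|V].
    apply: filter_from_filter; first by exists setT; exact: filterT.
    by move=> V W zV zW; exists (V `&` W) => //; exact: filterI.
  rewrite nbhsE => -[W [oW Wz] WV].
  have [w [Ww [x _ xw]]] := De W (ex_intro _ z Wz) oW.
  by exists x; apply: WV; rewrite xw.
have [|x Fx] := d_complete PF.
  move=> r /ex_inv[n nr]; have [V [oV Vd] Vz] := zO n I.
  exists (e @^-1` V); first by exists V => //; exact: open_nbhs_nbhs.
  by move=> x y Vx Vy; apply: lt_trans nr; exact: Vd.
exists x => //; apply: hK => A B Ax Bz.
have FB : F (e @^-1` B) by exists B.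
have [y [Ay By]] := @filter_ex _ F _ _ (@filterI _ F _ _ _ (Fx _ (ce _ _ Ax)) FB).
by exists (e y).
Qed.

Lemma complete_cech_complete : tychonoff_space X -> cech_complete X.
Proof.
move=> tX; split => //.
have [e ec] := closure_compactification (@ptws_hausdorff R X)
  distance_embedding distance_compact_closure.
by exists _, e; split => //; case: ec => hK _; exact: complete_Gdelta.
Qed.

End distance.

Lemma polish_lindelof_cech_complete (R : realType) (X : topologicalType) :
  polish_space R X ->
  [/\ lindelof X, cech_complete X & countable_pseudocharacter X].
Proof.
move=> [sX [M [f [cM [ef fsurj]]]]]; have [finj _] := ef.
pose d x y := mdist (f x) (f y).
have d0 x : d x x = 0 by exact: mdistxx.
have d_eq0 x y : d x y = 0 -> x = y by move=> /mdist_positivity /finj.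
have d_ge0 x y : 0 <= d x y by exact: mdist_ge0.
have d_sym x y : d x y = d y x by exact: metric_sym.
have d_tri y x z : d x z <= d x y + d y z by exact: metric_triangle.
have d_nbhs x U : nbhs x U <->
    exists2 e : R, 0 < e & [set y | d x y < e] `<=` U.
  rewrite (embedding_nbhs _ _ ef).
  rewrite -(@metricType_numDomainType.filter_from_mdist_nbhs R M (f x)).
  split=> [[V [e e0 eV] VU]|[e e0 eU]].
    by exists e => // y xy; apply: VU; exact: eV.
  exists [set m | mdist (f x) m < e] => //.
  by exists e.
split.
- exact: (@distance_lindelof R X d).
- apply: (@complete_cech_complete R X d) => //.
    move=> F PF Fd; pose G := f @ F.
    have [|m Gm] := cM G (fmap_proper_filter f PF).
      move=> E; rewrite /= -entourage_ballE => -[e e0 eE].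
      have [S FS Sd] := Fd e e0.
      have GS : G (f @` S) by apply: (@filterS _ F) FS => x Sx; exists x.
      exists (f @` S, f @` S) => // -[u v] [/= [x Sx <-] [y Sy <-]].
      by apply: eE; rewrite /= ballEmdist; exact: Sd.
    have [x _ xm] : range f m by rewrite fsurj.
    exists x => U /(embedding_nbhs _ _ ef)[V]; rewrite xm => /Gm Vm VU.
    exact: filterS VU Vm.
  apply: (@embedding_tychonoff R X M f ef); split.
    exact/hausdorff_accessible/metric_hausdorff.
  exact: (@uniform_completely_regular R).
- exact: (@distance_countable_pseudocharacter R X d).
Qed.

(** * The corollary *)

Theorem corollary6p10 (R : realType) (X : topologicalType) :
  (polish_space R X ->
     [/\ lindelof X, cech_complete X & countable_pseudocharacter X]) /\
  (lindelof X -> cech_complete X -> countable_pseudocharacter X ->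
     (normal_space (B1 R X) <-> countable [set: X]) /\
     (countable [set: X] ->
        [/\ B1 R X = [set: {ptws X -> R}],
            separable_space (B1 R X) &
            metrizable R (B1 R X)])).
Proof.
split; first exact: polish_lindelof_cech_complete.
move=> lX cX gX; split.
  split; first exact: normal_B1_countable.
  by move=> ctX; apply: (@metrizable_normal R); exact: countable_metrizable.
move=> ctX; have B1T : B1 R X = [set: {ptws X -> R}].
  by apply: B1_countable => //; case: cX.
split => //; first exact: B1_countable_separable.
exact: countable_metrizable.
Qed.
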